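(* For every integer $k\ge 1$, the $k$-th Laakso graph $\mathcal{L}_k$ satisfies $$d_1(\mathcal{L}_k)\leq sd_1(\mathcal{L}_k)\leq 8k.$$
   Context: Laakso graphs. $\mathcal{L}_1$ is the graph with 6 vertices $u_0,u_1,u_2,u_3,u_4,u_5$ and 6 edges $\{u_0,u_1\},\{u_1,u_2\},\{u_1,u_3\},\{u_2,u_4\},\{u_3,u_4\},\{u_4,u_5\}$. For $k\ge2$, $\mathcal{L}_k$ is obtained from $\mathcal{L}_{k-1}$ by replacing each edge $\{u,v\}\in E(\mathcal{L}_{k-1})$ by a copy of $\mathcal{L}_1$, where $u$ and $v$ are identified with the two vertices of degree 1 of that copy; thus $V(\mathcal{L}_{k-1})\subset V(\mathcal{L}_k)$. $\mathcal{L}_k$ also denotes the metric space $V(\mathcal{L}_k)$ with the graph distance in which every edge has length 1. The distinguished point $0$ of $\mathcal{L}_k$ is a vertex of $\mathcal{L}_1$ (chosen arbitrarily). Let $(M,d)$ be a finite metric space with $N+1$ points and distinguished point $0\in M$. $\mathrm{Lip}_0(M)$ is the space of functions $f:M\to\mathbb{R}$ with $f(0)=0$, normed by the least Lipschitz constant; $\mathcal{F}(M)$ is its dual normed space ($\dim\mathcal{F}(M)=N$). An element of $\mathcal{F}(M)$ is represented by a function $\mu:M\to\mathbb{R}$ acting by $\langle\mu,f\rangle=\sum_x\mu(x)f(x)$; the value $\mu(0)$ is irrelevant; $\delta_x$ is the indicator function of $x$. For a basis $(b_n)_{n=1}^N$ of $\mathcal{F}(M)$ with dual basis $(b_n^*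 )$, $d_1(b_n)=\max_{\|x\|=1}\sum_{n=1}^N|b_n^*(x)|\,\|b_n\|$. $d_1(M)$ is the Banach–Mazur distance between $\mathcal{F}(M)$ and $\ell_1^N$, equivalently the minimum of $d_1(b_n)$ over all bases of $\mathcal{F}(M)$. For $S\subset M$ with $0\in S$, identify $\mathcal{F}(S)$ with the span of $\{\delta_x:x\in S\}$; a stochastic retraction onto $S$ is a map $R$ from $M$ to the probability measures on $S$ with $R(x)=\delta_x$ for $x\in S$, and its linear extension $\widehat R:\mathcal{F}(M)\to\mathcal{F}(S)$, $\widehat R(\delta_x)=R(x)$, is also called a stochastic retraction. A basis is stochastic if all its canonical projections $P_n(x)=\sum_{i\le n}b_i^*(x)b_i$ are stochastic retractions, and $sd_1(M)=\min\{d_1(b_n):(b_n)\text{ stochastic basis of }\mathcal{F}(M)\}$. *)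

(* Defs.v *)
From HB Require Import structures.
From mathcomp Require Import all_boot all_order all_algebra.
From mathcomp Require Import all_classical all_reals all_analysis.

Set Implicit Arguments.
Unset Strict Implicit.
Unset Printing Implicit Defensive.

Import Order.TTheory GRing.Theory Num.Theory.
Local Open Scope classical_set_scope.
Local Open Scope ring_scope.

(** * Laakso graphs *)

(** Finite graphs with indexed edges.  The order in [ends e] is only used to
    decide which endpoint of [e] is glued to which end of a copy of L_1; since
    L_1 has the symmetry u_i <-> u_(5-i) (fixing u_2 and u_3), another order
    gives an isomorphic graph. *)
Record graph := Graph {
  vertex : finType;
  edge : finType;
  ends : edge -> vertex * vertex }.

Definition adjacent (G : graph) : rel (vertex G) := fun x y =>
  [exists e : edge G, (ends e == (x, y)) || (ends e == (y, x))].

Definition graph_dist (R : realType) (G : graph) (x y : vertex G) : R :=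
  inf [set (size p)%:R | p in
        [set p : seq (vertex G) | path (@adjacent G) x p /\ last x p = y]].

Definition L1_ends (e : 'I_6) : 'I_6 * 'I_6 :=
  let p := nth (0, 0)%N [:: (0, 1); (1, 2); (1, 3); (2, 4); (3, 4); (4, 5)]%N e
  in (inord p.1, inord p.2).

Definition L1 : graph := Graph L1_ends.

Section ReplaceEdges.
Variable G : graph.

(** The vertices of the new graph are the old ones, [inl x], and for each edge
    [e] the interior vertices u_1, ..., u_4 of the copy of L_1 replacing [e],
    the vertex u_i being [inr (e, j)] with [j = i - 1]. *)
Definition copy_vertex (e : edge G) (i : 'I_6) : vertex G + edge G * 'I_4 :=
  if i == ord0 then inl (ends e).1
  else if i == ord_max then inl (ends e).2
  else inr (e, inord i.-1).

Definition replace_edges : graph :=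
  @Graph (vertex G + edge G * 'I_4)%type (edge G * 'I_6)%type
    (fun ea => let: (e, a) := ea in
       (copy_vertex e (L1_ends a).1, copy_vertex e (L1_ends a).2)).

End ReplaceEdges.

(** [laakso_rec n] is the Laakso graph of index [n + 1]. *)
Fixpoint laakso_rec (n : nat) : graph :=
  if n is n'.+1 then replace_edges (laakso_rec n') else L1.

Definition laakso (k : nat) : graph := laakso_rec k.-1.

Fixpoint laakso_rec_incl (n : nat) : 'I_6 -> vertex (laakso_rec n) :=
  match n return 'I_6 -> vertex (laakso_rec n) with
  | 0 => fun i => i
  | n'.+1 => fun i => inl (laakso_rec_incl n' i)
  end.

Definition laakso_incl (k : nat) : 'I_6 -> vertex (laakso k) :=
  laakso_rec_incl k.-1.

(** * Lipschitz-free spaces of finite metric spaces *)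

(** The operator norm of [T] for the norms [nU] and [nV]. *)
Definition opnorm (R : realType) (U V : vectType R) (nU : U -> R) (nV : V -> R)
    (T : 'Hom(U, V)) : R :=
  sup [set nV (T x) | x in [set x : U | nU x <= 1]].

Definition l1norm (R : realType) (n : nat) (v : 'rV[R]_n) : R :=
  \sum_(i < n) `|v 0 i|.

Section LipschitzFree.
(** [d] is meant to be a metric on [M]; the distinguished point is [o]. *)
Variables (R : realType) (M : finType) (d : M -> M -> R) (o : M).

Definition Lip0 : {vspace {ffun M -> R^o}} :=
  lker (linfun (fun f : {ffun M -> R^o} => f o)).

Lemma mem_Lip0 (f : {ffun M -> R^o}) : (f \in Lip0) = (f o == 0).
Proof.
pose g (f : {ffun M -> R^o}) := f o.
have gl : linear g by move=> a u v; rewrite /g !ffunE.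
pose gL := GRing.isLinear.Build R _ _ _ g gl.
pose h : {linear {ffun M -> R^o} -> R^o} := HB.pack g gL.
by rewrite memv_ker (lfunE h).
Qed.

Definition lip_norm (f : subvs_of Lip0) : R :=
  inf [set L : R | 0 <= L /\
        forall x y : M, `|vsval f x - vsval f y| <= L * d x y].

Definition freeLip : vectType R := 'Hom(subvs_of Lip0, R^o).

Definition free_norm (mu : freeLip) : R :=
  opnorm lip_norm (fun r : R^o => `|r : R|) mu.

(** Evaluation at [x]; it vanishes for [x = o]. *)
Definition delta (x : M) : freeLip :=
  linfun (fun f : subvs_of Lip0 => vsval f x : R^o).

Lemma deltaE (x : M) (f : subvs_of Lip0) : delta x f = vsval f x.
Proof.
pose g (f : subvs_of Lip0) : R^o := vsval f x.
have gl : linear g by move=> a u v; rewrite /g linearP !ffunE.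
pose gL := GRing.isLinear.Build R _ _ _ g gl.
pose h : {linear subvs_of Lip0 -> R^o} := HB.pack g gL.
by rewrite /delta (lfunE h).
Qed.

Let N := #|M|.-1.

Definition d1_basis (b : N.-tuple freeLip) : R :=
  sup [set \sum_(i < N) `|coord b i x| * free_norm b`_i
      | x in [set x : freeLip | free_norm x = 1]].

(** The Banach-Mazur distance between [freeLip] and l_1^N.  Infima are taken
    in the extended reals, so that an infimum over the empty set is [+oo]. *)
Definition d1 : \bar R :=
  ereal_inf [set c | exists (T : 'Hom(freeLip, 'rV[R]_N))
                            (T' : 'Hom('rV[R]_N, freeLip)),
    [/\ cancel T T', cancel T' T &
        c = (opnorm free_norm (@l1norm R N) T *
             opnorm (@l1norm R N) free_norm T')%:E]].

(** [r x] is the (mass function of the) probability measure R(x) on [S]. *)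
Definition stochastic_retraction (S : {set M}) (r : M -> M -> R) : Prop :=
  [/\ o \in S,
      forall x y, 0 <= r x y,
      forall x, \sum_y r x y = 1,
      forall x y, y \notin S -> r x y = 0 &
      forall x y, x \in S -> r x y = (y == x)%:R].

(** [P] is the linear extension of a stochastic retraction. *)
Definition is_stochastic (P : freeLip -> freeLip) : Prop :=
  exists (S : {set M}) (r : M -> M -> R), stochastic_retraction S r /\
    forall x, P (delta x) = \sum_y r x y *: delta y.

Definition canonical_proj (b : N.-tuple freeLip) (n : 'I_N) (x : freeLip) :
    freeLip :=
  \sum_(i < N | (i <= n)%N) coord b i x *: b`_i.

Definition stochastic_basis (b : N.-tuple freeLip) : Prop :=
  basis_of fullv b /\ forall n, is_stochastic (canonical_proj b n).

Definition sd1 : \bar R :=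
  ereal_inf [set (d1_basis b)%:E | b in stochastic_basis].

End LipschitzFree.

(* Main.v *)
Require Import Defs.
From HB Require Import structures.
From mathcomp Require Import all_boot all_order all_algebra.
From mathcomp Require Import all_classical all_reals all_analysis.
From mathcomp Require Import ring.

(** For a probability measure q_z on points that come before z in some ordering
    of the space starting at the base point, let
      b_z = delta_z - sum_t q_z(t) delta_t.
    These vectors always form a stochastic basis: its canonical projections
    move the mass of the points not yet added to earlier points, according to
    the measures q_z ([residual_basis_stochastic]).  It remains to choose the
    ordering and the measures so that d_1 of the basis is small.

    By duality, d_1(b) is at most the largest value on molecules
    (delta_x - delta_y) / d(x, y) of the sum of the |b_n^*| ||b_n||
    ([d1_basis_le]), and in a graph it is enough to consider the edges
    ([graph_dist_edgewise]).  On L_1 take for q_z the unit mass at the base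
    point.  Since L_1 has diameter 4, each edge costs at most 4 + 4 = 8.  When
    the edges of a graph are replaced by copies of L_1, add the new vertices
    after the old ones, and average a vertex of the copy over the two ends of
    the copy according to its height (its distance to one end, between 0 and 4).
    Every edge of L_1 joins two consecutive heights, so a new edge equals the
    difference of two residuals of norm at most 4, plus one quarter of the edge
    that it belongs to.  The old distances are multiplied by 4, so this quarter
    costs as much as the old edge did before, and each refinement adds at most 8
    to the cost of an edge ([cheap_averaging_replace]).  For L_k this gives 8k.

    The inequality d_1 <= sd_1 holds because normalizing a basis gives an
    isomorphism onto l_1^N whose distortion is at most d_1 of the basis
    ([d1_le_d1_basis]). *)

Set Implicit Arguments.
Unset Strict Implicit.
Unset Printing Implicit Defensive.

Import Order.TTheory GRing.Theory Num.Theory.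
Local Open Scope ring_scope.

(** * The Lipschitz-free norm *)

Section FreeSpace.
Variables (R : realType) (M : finType) (o : M).

(** Subtracting the value at the base point makes every [g] an element of
    Lip_0, so that functions can be handled without a side condition. *)
Definition lip0 (g : M -> R) : subvs_of (Lip0 R o) :=
  vsproj (Lip0 R o) [ffun x => (g x - g o : R^o)].

Lemma lip0E (g : M -> R) x : vsval (lip0 g) x = g x - g o.
Proof. by rewrite vsprojK ?ffunE // mem_Lip0 ffunE subrr. Qed.

Lemma vsval_base (f : subvs_of (Lip0 R o)) : vsval f o = 0.
Proof. by apply/eqP; rewrite -mem_Lip0 subvsP. Qed.

Lemma Lip0_eq (f g : subvs_of (Lip0 R o)) : (forall x, vsval f x = vsval g x) -> f = g.
Proof. by move=> fg; apply/val_inj/ffunP => x; rewrite fg. Qed.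

Lemma vsvalZ a (f : subvs_of (Lip0 R o)) x : vsval (a *: f) x = a * vsval f x.
Proof. by rewrite linearZ ffunE. Qed.

Lemma Lip0_expand (f : subvs_of (Lip0 R o)) :
  f = \sum_y (vsval f y : R) *: lip0 (fun x => (x == y)%:R).
Proof.
apply: Lip0_eq => x; rewrite raddf_sum sum_ffunE.
under eq_bigr => y _ do rewrite vsvalZ lip0E mulrBr.
rewrite big_split /= sumrN (bigD1 x) //= eqxx mulr1.
rewrite big1 ?addr0; last by move=> y /negPf; rewrite eq_sym => ->; rewrite mulr0.
rewrite (bigD1 o) //= vsval_base mul0r add0r big1 ?subr0 //.
by move=> y /negPf; rewrite eq_sym => ->; rewrite mulr0.
Qed.

Lemma delta_base : delta R o o = 0.
Proof. by apply/lfunP => f; rewrite deltaE vsval_base lfunE. Qed.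

(** The indicators of points, shifted to vanish at [o], span Lip_0; the values
    of [mu] on them are its coefficients on the evaluations [delta]. *)
Lemma freeLip_expand (mu : freeLip R o) :
  mu = \sum_y (mu (lip0 (fun x => (x == y)%:R)) : R) *: delta R o y.
Proof.
apply/lfunP => f; rewrite {1}(Lip0_expand f) linear_sum sum_lfunE.
apply: eq_bigr => y _; rewrite linearZ scale_lfunE deltaE.
exact: mulrC.
Qed.

(** Reflexivity in the form used below: a linear form on the free space is
    the evaluation at the function that it induces on [M]. *)
Lemma functional_eval (phi : {linear freeLip R o -> R^o}) mu :
  phi mu = mu (lip0 (fun y => phi (delta R o y))).
Proof.
rewrite {1}(freeLip_expand mu) linear_sum [in RHS](Lip0_expand (lip0 _)) linear_sum.
apply: eq_bigr => y _; rewrite !linearZ lip0E delta_base linear0 subr0.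
exact: mulrC.
Qed.

(** [Lip0] is the kernel of one linear form on a space of dimension #|M|. *)
Lemma freeLip_dim : (#|M|.-1 <= \dim (fullv : {vspace freeLip R o}))%N.
Proof.
rewrite dimvf /freeLip.
have -> : dim 'Hom(subvs_of (Lip0 R o), R^o) = \dim (Lip0 R o) by rewrite /dim /= muln1.
have := limg_ker_dim (linfun (fun f : {ffun M -> R^o} => f o)) fullv.
rewrite capfv -/(Lip0 R o) dimvf => e.
have dM : dim {ffun M -> R^o} = #|M| by rewrite /dim /= muln1.
rewrite dM in e.
have := dimvS (subvf (linfun (fun f : {ffun M -> R^o} => f o) @: fullv)%VS).
rewrite [X in (_ <= X)%N]dimvf /=; set t := (\dim (_ @: _)) in e *.
have -> : dim R^o = 1%N by [].
by move=> t1; rewrite -e -subn1 leq_subLR addnC; exact: leq_add.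
Qed.

Variable d : M -> M -> R.
Hypothesis d_ge0 : forall x y, 0 <= d x y.
Hypothesis d_gt0 : forall x y, x != y -> 0 < d x y.
Local Open Scope classical_set_scope.

(** The sum of all slopes is an admissible constant; it is finite because
    [d] does not vanish off the diagonal. *)
Lemma lip_set_nonempty (f : subvs_of (Lip0 R o)) :
  [set L : R | 0 <= L /\ forall x y : M, `|vsval f x - vsval f y| <= L * d x y] !=set0.
Proof.
exists (\sum_(p : M * M) `|vsval f p.1 - vsval f p.2| / d p.1 p.2); split => [|x y].
  by apply: sumr_ge0 => p _; rewrite divr_ge0.
have [->|xy] := eqVneq x y.
  rewrite subrr normr0 mulr_ge0 //.
  by apply: sumr_ge0 => p _; rewrite divr_ge0.
rewrite -ler_pdivrMr ?d_gt0 // (bigD1 (x, y)) //= lerDl.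
by apply: sumr_ge0 => p _; rewrite divr_ge0.
Qed.

Lemma lip_norm_ge0 (f : subvs_of (Lip0 R o)) : 0 <= lip_norm d f.
Proof. by apply: lb_le_inf; [exact: lip_set_nonempty|move=> L []]. Qed.

Lemma lip_norm_le (f : subvs_of (Lip0 R o)) L : 0 <= L ->
  (forall x y, `|vsval f x - vsval f y| <= L * d x y) -> lip_norm d f <= L.
Proof. by move=> L0 fL; apply: ge_inf; [exists 0 => ? []|]. Qed.

Lemma lip_normP (f : subvs_of (Lip0 R o)) x y :
  `|vsval f x - vsval f y| <= lip_norm d f * d x y.
Proof.
have [->|xy] := eqVneq x y.
  by rewrite subrr normr0 mulr_ge0 ?lip_norm_ge0.
rewrite -ler_pdivrMr ?d_gt0 //; apply: lb_le_inf; first exact: lip_set_nonempty.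
by move=> L [_ fL]; rewrite ler_pdivrMr ?d_gt0.
Qed.

Lemma lip_norm_eq0 (f : subvs_of (Lip0 R o)) : lip_norm d f = 0 -> f = 0.
Proof.
move=> f0; apply: Lip0_eq => x; rewrite linear0 ffunE.
have := lip_normP f x o; rewrite f0 mul0r vsval_base subr0 normr_le0.
by move/eqP.
Qed.

(** Without this bound the supremum defining [free_norm] would be 0 by
    convention: |f y| <= d(y, o) for every 1-Lipschitz [f] vanishing at [o]. *)
Lemma free_norm_bounded (mu : freeLip R o) :
  has_ubound [set `|mu f : R| | f in [set f | lip_norm d f <= 1]].
Proof.
exists (\sum_y d y o * `|mu (lip0 (fun x => (x == y)%:R)) : R|) => _ [f f1 <-].
rewrite {1}(Lip0_expand f) linear_sum; apply: le_trans (ler_norm_sum _ _ _) _.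
apply: ler_sum => y _; rewrite linearZ /= normrM ler_wpM2r //.
have := lip_normP f y o; rewrite vsval_base subr0 => /le_trans; apply.
by rewrite ler_piMl.
Qed.

Lemma free_norm_ub (mu : freeLip R o) f : lip_norm d f <= 1 -> `|mu f : R| <= free_norm d mu.
Proof. by move=> f1; apply: ub_le_sup (free_norm_bounded mu) _ _; exists f. Qed.

Lemma lip_norm0 : lip_norm d (0 : subvs_of (Lip0 R o)) = 0.
Proof.
apply/eqP; rewrite eq_le lip_norm_ge0 andbT lip_norm_le // => x y.
by rewrite linear0 !ffunE subrr normr0 mul0r.
Qed.

Lemma free_norm_le (mu : freeLip R o) C :
  (forall f, lip_norm d f <= 1 -> `|mu f : R| <= C) -> free_norm d mu <= C.
Proof.
move=> muC; apply: ge_sup; last by move=> _ [f f1 <-]; exact: muC.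
by exists `|mu 0 : R|, 0 => //=; rewrite lip_norm0.
Qed.

Lemma free_norm_ge0 (mu : freeLip R o) : 0 <= free_norm d mu.
Proof. by apply: le_trans (free_norm_ub mu (f := 0) _); rewrite ?lip_norm0. Qed.

Lemma free_normP (mu : freeLip R o) f : `|mu f : R| <= free_norm d mu * lip_norm d f.
Proof.
have [f0|f0] := eqVneq (lip_norm d f) 0.
  by rewrite f0 (lip_norm_eq0 f0) linear0 normr0 mulr0.
have fp : 0 < lip_norm d f by rewrite lt_neqAle eq_sym f0 lip_norm_ge0.
rewrite -ler_pdivrMr //.
have -> : `|mu f : R| / lip_norm d f = `|mu ((lip_norm d f)^-1 *: f) : R|.
  by rewrite linearZ /= normrM mulrC gtr0_norm ?invr_gt0.
apply: free_norm_ub; apply: lip_norm_le => // x y.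
rewrite !vsvalZ -mulrBr normrM gtr0_norm ?invr_gt0 // ler_pdivrMl // mul1r.
exact: lip_normP.
Qed.

Lemma free_norm_eq0 (mu : freeLip R o) : free_norm d mu = 0 -> mu = 0.
Proof.
move=> mu0; apply/lfunP => f; rewrite lfunE /=.
by have := free_normP mu f; rewrite mu0 mul0r normr_le0 => /eqP.
Qed.

Lemma free_norm0 : free_norm d (0 : freeLip R o) = 0.
Proof.
apply/eqP; rewrite eq_le free_norm_ge0 andbT free_norm_le // => f _.
by rewrite lfunE normr0.
Qed.

Lemma free_normZ a (mu : freeLip R o) : free_norm d (a *: mu) = `|a| * free_norm d mu.
Proof.
have le b nu : free_norm d (b *: nu : freeLip R o) <= `|b| * free_norm d nu.
  apply: free_norm_le => f f1; rewrite scale_lfunE normrM ler_wpM2l //.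
  exact: free_norm_ub.
apply/eqP; rewrite eq_le le /=.
have [->|a0] := eqVneq a 0; first by rewrite normr0 mul0r free_norm_ge0.
rewrite -ler_pdivlMl ?normr_gt0 // -normfV; apply: le_trans (le _ _).
by rewrite scalerA mulVf // scale1r.
Qed.

Lemma free_norm_sum (I : finType) (mu : I -> freeLip R o) :
  free_norm d (\sum_i mu i) <= \sum_i free_norm d (mu i).
Proof.
apply: free_norm_le => f f1; rewrite sum_lfunE; apply: le_trans (ler_norm_sum _ _ _) _.
by apply: ler_sum => i _; exact: free_norm_ub.
Qed.

Lemma free_norm_deltaB x y : free_norm d (delta R o x - delta R o y) <= d x y.
Proof.
apply: free_norm_le => f f1; rewrite add_lfunE opp_lfunE !deltaE.
apply: le_trans (lip_normP f x y) _.
by rewrite ler_piMl.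
Qed.

(** Bounding a linear form on the unit ball of the free space amounts to
    bounding it on the molecules, since its norm is the Lipschitz constant of
    the function that it induces; no description of the extreme points of the
    ball is involved. *)
Lemma functional_le (phi : {linear freeLip R o -> R^o}) C : 0 <= C ->
  (forall x y, `|phi (delta R o x) - phi (delta R o y) : R| <= C * d x y) ->
  forall mu, `|phi mu : R| <= C * free_norm d mu.
Proof.
move=> C0 phiC mu; rewrite functional_eval; apply: le_trans (free_normP _ _) _.
rewrite mulrC ler_wpM2r ?free_norm_ge0 //; apply: lip_norm_le => // x y.
by rewrite !lip0E opprB addrA subrK.
Qed.

Lemma functional_bounded (phi : {linear freeLip R o -> R^o}) :
  exists C, forall mu, `|phi mu : R| <= C * free_norm d mu.
Proof.
exists (lip_norm d (lip0 (fun y => phi (delta R o y)))) => mu.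
by rewrite functional_eval mulrC; exact: free_normP.
Qed.

End FreeSpace.

(** * The constant d_1 of a basis *)

Lemma nonneg_sup (R : realType) (E : set R) : (forall x, E x -> 0 <= x) -> 0 <= sup E.
Proof.
move=> E0; have [supE|noE] := pselect (has_sup E); last by rewrite sup_out.
have [[x Ex] ubE] := supE.
exact: le_trans (E0 x Ex) (ub_le_sup ubE Ex).
Qed.

Section D1Basis.
Variables (R : realType) (M : finType) (o : M) (d : M -> M -> R).
Hypothesis d_ge0 : forall x y, 0 <= d x y.
Hypothesis d_gt0 : forall x y, x != y -> 0 < d x y.
Local Open Scope classical_set_scope.
Let N := #|M|.-1.
Implicit Types b : N.-tuple (freeLip R o).

Lemma d1_basis_bounded b :
  has_ubound [set \sum_(i < N) `|coord b i x| * free_norm d b`_i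
             | x in [set x : freeLip R o | free_norm d x = 1]].
Proof.
have /choice[C cC] : forall i : 'I_N, exists C, forall mu,
    `|coord b i mu : R| <= C * free_norm d mu.
  by move=> i; exact: (functional_bounded d_ge0 d_gt0 (coord b i)).
exists (\sum_i C i * free_norm d b`_i) => _ [x x1 <-].
apply: ler_sum => i _; rewrite ler_wpM2r ?free_norm_ge0 //.
by rewrite (le_trans (cC i x)) // x1 mulr1.
Qed.

Lemma d1_basisP b x :
  \sum_(i < N) `|coord b i x| * free_norm d b`_i <= d1_basis d b * free_norm d x.
Proof.
have [x0|x0] := eqVneq (free_norm d x) 0.
  rewrite x0 (free_norm_eq0 d_ge0 d_gt0 x0) mulr0 big1 // => i _.
  by rewrite linear0 normr0 mul0r.
have xp : 0 < free_norm d x by rewrite lt_neqAle eq_sym x0 free_norm_ge0.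
rewrite -ler_pdivrMr //; apply: ub_le_sup (d1_basis_bounded b) _ _.
exists ((free_norm d x)^-1 *: x) => /=.
  by rewrite free_normZ // gtr0_norm ?invr_gt0 // mulVf.
rewrite mulr_suml; apply: eq_bigr => i _.
by rewrite linearZ /= normrM gtr0_norm ?invr_gt0 // -mulrA mulrC.
Qed.

Lemma d1_basis_ge0 b : 0 <= d1_basis d b.
Proof.
apply: nonneg_sup => _ [x _ <-].
by apply: sumr_ge0 => i _; rewrite mulr_ge0 ?free_norm_ge0.
Qed.

(** At a given [x] the sum of absolute values agrees with the linear form
    whose coefficients carry the signs of the coordinates of [x]; on molecules
    that form is dominated by the sum of absolute values, and
    [functional_le] applies. *)
Lemma d1_basis_le b C : 0 <= C ->
  (forall x y, \sum_(i < N) `|coord b i (delta R o x - delta R o y)| *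
     free_norm d b`_i <= C * d x y) -> d1_basis d b <= C.
Proof.
move=> C0 bC; rewrite /d1_basis; set S := (X in sup X).
have [->|/set0P S0] := eqVneq S set0; first by rewrite sup0.
apply: ge_sup => // _ [x x1 <-].
pose a i : R := Num.sg (coord b i x) * free_norm d b`_i.
pose phi : 'Hom(freeLip R o, R^o) := \sum_i a i *: linfun (coord b i : _ -> R^o).
have phiE mu : phi mu = \sum_i a i * coord b i mu :> R.
  by rewrite sum_lfunE; apply: eq_bigr => i _; rewrite scale_lfunE lfunE.
have -> : \sum_(i < N) `|coord b i x| * free_norm d b`_i = phi x.
  by rewrite phiE; apply: eq_bigr => i _; rewrite normrEsg mulrAC.
rewrite -[leRHS]mulr1 -[in leRHS]x1; apply: le_trans (ler_norm _) _.
apply: functional_le => // y z; rewrite -linearB /= phiE.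
apply: le_trans (ler_norm_sum _ _ _) (le_trans _ (bC y z)).
apply: ler_sum => i _; rewrite normrM mulrC ler_wpM2l // normrM.
rewrite (ger0_norm (free_norm_ge0 _ _ _)) // ler_piMl ?free_norm_ge0 //.
by rewrite normr_sg; case: (_ != 0).
Qed.

(** Rescaling the basis vectors to norm one gives an isomorphism T from the
    free space to l_1^N: its norm is at most [d1_basis d b], and the triangle
    inequality shows that its inverse has norm at most 1. *)
Lemma d1_le_d1_basis b : basis_of fullv b -> (d1 d o <= (d1_basis d b)%:E)%E.
Proof.
move=> bb; have fb := basis_free bb.
have nz (i : 'I_N) : free_norm d b`_i != 0.
  apply/negP => /eqP /(free_norm_eq0 d_ge0 d_gt0) b0.
  have := coord_free i i fb; rewrite b0 linear0 eqxx => /eqP.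
  by rewrite eq_sym oner_eq0.
pose t (x : freeLip R o) : 'rV[R]_N := \row_i (coord b i x * free_norm d b`_i).
have tl : linear t.
  by move=> a x y; apply/rowP => i; rewrite !mxE linearP mulrDl mulrA.
pose t' (v : 'rV[R]_N) : freeLip R o := \sum_i (v 0 i / free_norm d b`_i) *: b`_i.
have tl' : linear t'.
  move=> a x y; rewrite scaler_sumr -big_split; apply: eq_bigr => i _.
  by rewrite !mxE mulrDl scalerDl scalerA mulrA.
pose tL : {linear freeLip R o -> 'rV[R]_N} :=
  HB.pack t (GRing.isLinear.Build R _ _ _ t tl).
pose tL' : {linear 'rV[R]_N -> freeLip R o} :=
  HB.pack t' (GRing.isLinear.Build R _ _ _ t' tl').
have TE x : linfun t x = t x by rewrite (lfunE tL).
have TE' v : linfun t' v = t' v by rewrite (lfunE tL').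
have ct' i v : coord b i (t' v) = v 0 i / free_norm d b`_i.
  rewrite linear_sum (bigD1 i) //= linearZ /= coord_free // eqxx mulr1.
  rewrite big1 ?addr0 // => j ji.
  by rewrite linearZ /= coord_free // (negPf ji) mulr0.
have TK : cancel (linfun t) (linfun t').
  move=> x; rewrite TE TE' [RHS](coord_basis bb (memvf x)).
  by apply: eq_bigr => i _; rewrite mxE mulfK.
have TK' : cancel (linfun t') (linfun t).
  by move=> v; rewrite TE TE'; apply/rowP => i; rewrite mxE ct' divfK.
have T1 : opnorm (@free_norm R M d o) (@l1norm R N) (linfun t) <= d1_basis d b.
  apply: ge_sup.
    by exists (l1norm (linfun t 0)), 0 => //=; rewrite free_norm0.
  move=> _ [x x1 <-]; rewrite TE /l1norm.
  under eq_bigr => i _ do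
    rewrite mxE normrM (ger0_norm (free_norm_ge0 d_ge0 d_gt0 _)).
  by rewrite (le_trans (d1_basisP b x)) // ler_piMr ?d1_basis_ge0.
have T2 : opnorm (@l1norm R N) (@free_norm R M d o) (linfun t') <= 1.
  apply: ge_sup.
    exists (free_norm d (linfun t' 0)), 0 => //=.
    by rewrite /l1norm big1 // => i _; rewrite mxE normr0.
  move=> _ [v v1 <-]; rewrite TE'; apply: le_trans (free_norm_sum _ _ _) _ => //.
  apply: le_trans v1; apply: ler_sum => i _.
  rewrite free_normZ // normrM normfV (ger0_norm (free_norm_ge0 _ _ _)) //.
  by rewrite divfK.
have T0 : 0 <= opnorm (@l1norm R N) (@free_norm R M d o) (linfun t').
  by apply: nonneg_sup => _ [v _ <-]; exact: free_norm_ge0.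
apply: le_trans (ereal_inf_lbound _) _.
  by exists (linfun t), (linfun t'); split; [exact: TK|exact: TK'|reflexivity].
rewrite lee_fin -[leRHS]mulr1; apply: ler_pM => //.
apply: nonneg_sup => _ [v _ <-].
by apply: sumr_ge0.
Qed.

Lemma d1_le_sd1 : (d1 d o <= sd1 d o)%E.
Proof. by apply: le_ereal_inf_tmp => _ [b [bb _] <-]; exact: d1_le_d1_basis. Qed.

End D1Basis.

(** * Stochastic bases from averaging orders *)

Section Averaging.
Variables (R : realType) (M : finType) (o : M).

(** The points are added in the order [o :: s], and [q x] is a probability
    measure on the points that come before [x].  The base point is its own
    average, so that sums over all points need not single it out: its residual
    is zero. *)
Record averaging (s : seq M) (q : M -> M -> R) : Prop := Averaging {
  averaging_uniq : uniq (o :: s);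
  averaging_enum : forall x, x \in o :: s;
  averaging_ge0 : forall x y, 0 <= q x y;
  averaging_sum : forall x, \sum_y q x y = 1;
  averaging_base : forall y, q o y = (y == o)%:R;
  averaging_before : forall x y, x != o -> q x y != 0 ->
    (index y (o :: s) < index x (o :: s))%N }.

(** The new direction that [z] contributes: its deviation from its average
    over earlier points. *)
Definition residual (q : M -> M -> R) (z : M) : freeLip R o :=
  delta R o z - \sum_y q z y *: delta R o y.

Definition residual_basis (s : seq M) (q : M -> M -> R) : #|M|.-1.-tuple (freeLip R o) :=
  [tuple residual q (nth o s i) | i < #|M|.-1].

Lemma canonical_proj_linear (b : #|M|.-1.-tuple (freeLip R o)) n :
  linear (canonical_proj b n).
Proof.
move=> a u v; rewrite /canonical_proj scaler_sumr -big_split.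
by apply: eq_bigr => i _; rewrite linearP scalerDl scalerA.
Qed.

Lemma canonical_proj_basis (b : #|M|.-1.-tuple (freeLip R o)) n (i : 'I_#|M|.-1) :
  free b -> canonical_proj b n b`_i = if (i <= n)%N then b`_i else 0.
Proof.
move=> fb; rewrite /canonical_proj; case: ifP => ni.
  rewrite (bigD1 i) //= coord_free // eqxx scale1r big1 ?addr0 // => j /andP[_ ji].
  by rewrite coord_free // eq_sym (negPf ji) scale0r.
rewrite big1 // => j jn; rewrite coord_free //.
by case: eqVneq jn => [<-|_ _]; rewrite ?ni // scale0r.
Qed.

Section Basis.
Variables (s : seq M) (q : M -> M -> R).
Hypothesis sq : averaging s q.
Let b := residual_basis s q.

Lemma averaging_size : size s = #|M|.-1.
Proof.
have /perm_size/= : perm_eq (o :: s) (enum M).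
  apply: uniq_perm; [exact: averaging_uniq sq|exact: enum_uniq|move=> x].
  by rewrite (averaging_enum sq) mem_enum.
by rewrite -cardT => <-.
Qed.

Lemma averaging_index (i : 'I_#|M|.-1) : index (nth o s i) (o :: s) = i.+1.
Proof.
have -> : nth o s i = nth o (o :: s) i.+1 by [].
by rewrite index_uniq ?(averaging_uniq sq) //= ltnS averaging_size.
Qed.

Lemma averaging_nth x : x != o -> exists i : 'I_#|M|.-1, x = nth o s i.
Proof.
move=> xo; have := averaging_enum sq x; rewrite inE (negPf xo) /= => xs.
have ix : (index x s < #|M|.-1)%N by rewrite -averaging_size index_mem.
by exists (Ordinal ix); rewrite /= nth_index.
Qed.

(** Since [q x] only charges points before [x], a property may be proved at
    [x] from its validity on the support of [q x]. *)
Lemma averaging_ind (P : M -> Prop) : P o ->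
  (forall x, x != o -> (forall y, q x y != 0 -> P y) -> P x) -> forall x, P x.
Proof.
move=> Po Pstep x; have [n xn] := ubnP (index x (o :: s)).
elim: n => // n IH in x xn *; have [->//|xo] := eqVneq x o.
apply: Pstep => // y qy; apply: IH.
exact: leq_trans (averaging_before sq xo qy) xn.
Qed.

Lemma averaging_bigE (V : nmodType) (F : M -> V) :
  \sum_z F z = F o + \sum_(i < #|M|.-1) F (nth o s i).
Proof.
have e : perm_eq (index_enum M) (o :: s).
  apply: uniq_perm; [exact: index_enum_uniq|exact: averaging_uniq sq|move=> x].
  by rewrite (averaging_enum sq) mem_index_enum.
by rewrite (perm_big _ e) big_cons (big_nth o) big_mkord averaging_size.
Qed.

Lemma residual_base : residual q o = 0.
Proof.
rewrite /residual delta_base (bigD1 o) //= delta_base scaler0 !add0r.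
rewrite big1 ?oppr0 // => y yo.
by rewrite (averaging_base sq) (negPf yo) scale0r.
Qed.

Lemma delta_residual x : delta R o x = residual q x + \sum_y q x y *: delta R o y.
Proof. by rewrite subrK. Qed.

Lemma residual_basisE (i : 'I_#|M|.-1) : b`_i = residual q (nth o s i).
Proof. by rewrite -tnth_nth tnth_mktuple. Qed.

(** Unwinding [delta x = residual x + average] down to [o] writes every
    [delta x] in the residuals, which are no more than the dimension. *)
Lemma residual_basis_of : basis_of fullv b.
Proof.
have bP x : delta R o x \in <<b>>%VS.
  elim/averaging_ind: x => [|x xo IH]; first by rewrite delta_base mem0v.
  rewrite delta_residual rpredD //.
    have [i ->] := averaging_nth xo; rewrite -residual_basisE.
    by rewrite memv_span ?mem_nth // size_tuple.
  apply: rpred_sum => y _; have [->|qy] := eqVneq (q x y) 0.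
    by rewrite scale0r mem0v.
  by rewrite rpredZ // IH.
rewrite basisEdim size_tuple freeLip_dim andbT; apply/subvP => mu _.
by rewrite (freeLip_expand mu) rpred_sum // => y _; rewrite rpredZ.
Qed.

(** The projection P_n fixes [delta x] for the points already added and kills
    the residual of each later point, so P_n (delta x) is the q x-average of
    the P_n (delta y).  An average of probability measures on S is again one,
    whence the retraction by induction along the order. *)
Lemma residual_basis_stochastic : stochastic_basis b.
Proof.
split=> [|n]; first exact: residual_basis_of.
have fb := basis_free residual_basis_of.
pose P : {linear freeLip R o -> freeLip R o} := HB.pack (canonical_proj b n)
  (GRing.isLinear.Build R _ _ _ (canonical_proj b n) (canonical_proj_linear b n)).
(* The first n + 1 basis vectors involve n + 2 points, the base point having
   index 0. *)
pose S := [set z | (index z (o :: s) <= n.+1)%N].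
have Pres x : x != o -> P (residual q x) = if x \in S then residual q x else 0.
  move=> xo; have [i ->] := averaging_nth xo.
  by rewrite -residual_basisE /= canonical_proj_basis // inE averaging_index.
have Pdelta x : P (delta R o x) = P (residual q x) + \sum_y q x y *: P (delta R o y).
  rewrite {1}delta_residual linearD linear_sum; congr (_ + _).
  by apply: eq_bigr => y _; rewrite linearZ.
have PS x : x \in S -> P (delta R o x) = delta R o x.
  elim/averaging_ind: x => [|x xo IH] xS; first by rewrite delta_base linear0.
  rewrite Pdelta Pres // xS [RHS]delta_residual; congr (_ + _).
  apply: eq_bigr => y _; have [->|qy] := eqVneq (q x y) 0; first by rewrite !scale0r.
  rewrite IH // inE.
  by apply: leq_trans (ltnW (averaging_before sq xo qy)) _; rewrite inE in xS.
have /choice[r rP] : forall x, exists r : M -> R, [/\ forall y, 0 <= r y,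
    \sum_y r y = 1, forall y, y \notin S -> r y = 0,
    x \in S -> forall y, r y = (y == x)%:R &
    P (delta R o x) = \sum_y r y *: delta R o y].
  have inS x : x \in S -> exists r : M -> R, [/\ forall y, 0 <= r y,
      \sum_y r y = 1, forall y, y \notin S -> r y = 0,
      x \in S -> forall y, r y = (y == x)%:R &
      P (delta R o x) = \sum_y r y *: delta R o y].
    move=> xS; exists (fun y => (y == x)%:R); split => //.
    - rewrite (bigD1 x) //= eqxx big1 ?addr0 // => y /negPf -> //.
    - by move=> y yS; have [e|//] := eqVneq y x; rewrite e xS in yS.
    - rewrite PS // (bigD1 x) //= eqxx scale1r big1 ?addr0 // => y /negPf ->.
      by rewrite scale0r.
  move=> x; elim/averaging_ind: x => [|x xo IH]; first by apply: inS; rewrite inE /= eqxx.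
  have [xS|/negP xS] := pselect (x \in S); first exact: inS.
  have /choice[r rP] : forall y, exists r : M -> R, q x y != 0 -> [/\ forall z, 0 <= r z,
      \sum_z r z = 1, forall z, z \notin S -> r z = 0,
      y \in S -> forall z, r z = (z == y)%:R &
      P (delta R o y) = \sum_z r z *: delta R o z].
    move=> y; have [_|/IH[r rP]] := eqVneq (q x y) 0; first by exists (fun=> 0).
    by exists r.
  exists (fun z => \sum_y q x y * r y z); split => [z||z zS||] //.
  - apply: sumr_ge0 => y _; have [->|/rP[r0 _ _ _ _]] := eqVneq (q x y) 0.
      by rewrite mul0r.
    by rewrite mulr_ge0 // (averaging_ge0 sq).
  - rewrite exchange_big /= -(averaging_sum sq x); apply: eq_bigr => y _.
    rewrite -mulr_sumr; have [->|/rP[_ -> _ _ _]] := eqVneq (q x y) 0.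
      by rewrite mul0r.
    by rewrite mulr1.
  - rewrite big1 // => y _; have [->|/rP[_ _ -> // _ _]] := eqVneq (q x y) 0.
      by rewrite mul0r.
    by rewrite mulr0.
  - by rewrite (negPf xS).
  - rewrite Pdelta Pres // (negPf xS) add0r.
    under [RHS]eq_bigr => z _ do rewrite scaler_suml.
    rewrite [RHS]exchange_big; apply: eq_bigr => y _.
    have [->|/rP[_ _ _ _ ->]] := eqVneq (q x y) 0.
      by rewrite scale0r big1 // => z _; rewrite mul0r scale0r.
    by rewrite scaler_sumr; apply: eq_bigr => z _; rewrite scalerA.
exists S, r; split=> [|x]; last by have [_ _ _ _ <-] := rP x.
split=> [|x y|x|x y yS|x y xS]; first by rewrite inE /= eqxx.
- by have [] := rP x.
- by have [] := rP x.
- by have [_ _ ->] := rP x.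
- by have [_ _ _ ->] := rP x.
Qed.

(** Coordinates in the residual basis can be read off from an identity between
    values of an arbitrary function, which keeps the free space out of the
    combinatorial part of the argument.  The term of index [o] vanishes. *)
Lemma coord_residual (c : M -> R) x y :
  (forall f : M -> R, f x - f y = \sum_z c z * (f z - \sum_t q z t * f t)) ->
  forall i : 'I_#|M|.-1, coord b i (delta R o x - delta R o y) = c (nth o s i).
Proof.
move=> cxy i.
have -> : delta R o x - delta R o y = \sum_z c z *: residual q z.
  apply/lfunP => f; rewrite add_lfunE opp_lfunE !deltaE cxy sum_lfunE.
  apply: eq_bigr => z _; rewrite scale_lfunE add_lfunE opp_lfunE deltaE sum_lfunE.
  congr (_ * (_ - _)); apply: eq_bigr => t _.
  by rewrite scale_lfunE deltaE.
rewrite averaging_bigE residual_base scaler0 add0r.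
under eq_bigr => j _ do rewrite -residual_basisE.
by rewrite coord_sum_free // (basis_free residual_basis_of).
Qed.

End Basis.
End Averaging.

Section AveragingCost.
Variables (R : realType) (M : finType) (o : M) (s : seq M) (q : M -> M -> R).
Hypothesis sq : averaging o s q.
Variable d : M -> M -> R.
Hypothesis d_ge0 : forall x y, 0 <= d x y.
Hypothesis d_gt0 : forall x y, x != y -> 0 < d x y.

(** The residual of [z] is the q z-average of the molecules
    [delta z - delta t]. *)
Lemma residual_norm (w : M -> R) z : (forall t, q z t != 0 -> d z t <= w z) ->
  free_norm d (residual o q z) <= w z.
Proof.
move=> wz.
have -> : residual o q z = \sum_t q z t *: (delta R o z - delta R o t).
  under eq_bigr => t _ do rewrite scalerBr.
  by rewrite big_split /= sumrN -scaler_suml (averaging_sum sq) scale1r.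
apply: le_trans (free_norm_sum d_ge0 d_gt0 _) _.
rewrite -[leRHS]mul1r -(averaging_sum sq z) mulr_suml; apply: ler_sum => t _.
rewrite free_normZ // ger0_norm ?(averaging_ge0 sq) //.
have [->|qt] := eqVneq (q z t) 0; first by rewrite !mul0r.
rewrite ler_wpM2l ?(averaging_ge0 sq) //.
exact: le_trans (free_norm_deltaB o d_ge0 d_gt0 z t) (wz t qt).
Qed.

Lemma residual_basis_cost (w : M -> R) (c : M -> R) x y :
  (forall z t, q z t != 0 -> d z t <= w z) ->
  (forall f : M -> R, f x - f y = \sum_z c z * (f z - \sum_t q z t * f t)) ->
  \sum_(i < #|M|.-1) `|coord (residual_basis o s q) i (delta R o x - delta R o y)| *
      free_norm d (residual_basis o s q)`_i
    <= \sum_z `|c z| * w z.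
Proof.
move=> wq cxy; rewrite (averaging_bigE sq).
rewrite -[leLHS]add0r lerD //.
  rewrite mulr_ge0 //; apply: (le_trans _ (residual_norm (wq o))).
  exact: free_norm_ge0.
apply: ler_sum => i _; rewrite (coord_residual sq cxy) residual_basisE.
apply: ler_wpM2l => //; exact: residual_norm (wq _).
Qed.

End AveragingCost.

(** * Walks and the graph distance *)

Definition walk (G : graph) (m : nat) (x y : vertex G) : Prop :=
  exists p, [/\ path (@Defs.adjacent G) x p, last x p = y & (size p <= m)%N].

Definition connected_graph (G : graph) : Prop :=
  forall x y : vertex G, exists m, walk m x y.

Section Walks.
Variable G : graph.
Implicit Types x y z : vertex G.

Lemma walk_refl x : walk 0 x x. Proof. by exists [::]. Qed.

Lemma walk_le m n x y : (m <= n)%N -> walk m x y -> walk n x y.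
Proof. by move=> mn [p [xp py pm]]; exists p; split=> //; exact: leq_trans mn. Qed.

Lemma walk_trans y m n x z : walk m x y -> walk n y z -> walk (m + n) x z.
Proof.
move=> [p [xp py pm]] [r [yr rz rn]]; exists (p ++ r); split.
- by rewrite cat_path xp py.
- by rewrite last_cat py.
- by rewrite size_cat leq_add.
Qed.

Lemma adjacent_sym : symmetric (@Defs.adjacent G).
Proof. by move=> x y; apply/eq_existsb => e; rewrite orbC. Qed.

Lemma walk_sym m x y : walk m x y -> walk m y x.
Proof.
move=> [p [xp py pm]]; exists (rev (belast x p)); split.
- rewrite -py rev_path; apply: sub_path xp => u v.
  by rewrite adjacent_sym.
- case: p {pm} => [|u p] /= in xp py *; first by [].
  by rewrite rev_cons last_rcons.
- by rewrite size_rev size_belast.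
Qed.

Lemma walk_edge (e : edge G) : walk 1 (ends e).1 (ends e).2.
Proof.
exists [:: (ends e).2]; split => //=; rewrite andbT.
by apply/existsP; exists e; rewrite -surjective_pairing eqxx.
Qed.

Section Dist.
Variable R : realType.
Local Open Scope classical_set_scope.

Lemma graph_dist_le_walk m x y : walk m x y -> graph_dist R x y <= m%:R.
Proof.
move=> [p [xp py pm]]; apply: (@le_trans _ _ (size p)%:R); last by rewrite ler_nat.
by apply: ge_inf; [exists 0 => _ [r _ <-]|exists p].
Qed.

Hypothesis Gc : connected_graph G.

Lemma walk_set_nonempty x y :
  [set ((size p)%:R : R) | p in [set p | path (@Defs.adjacent G) x p /\ last x p = y]] !=set0.
Proof. by have [m [p [xp py _]]] := Gc x y; exists (size p)%:R, p. Qed.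

Lemma graph_dist_ge0 x y : 0 <= graph_dist R x y.
Proof. by apply: lb_le_inf; [exact: walk_set_nonempty|move=> _ [p _ <-]]. Qed.

Lemma graph_dist_gt0 x y : x != y -> 0 < graph_dist R x y.
Proof.
move=> xy; apply: (@lt_le_trans _ _ 1) => //.
apply: lb_le_inf; first exact: walk_set_nonempty.
move=> _ [[|u p] [_ /= py] <-]; last by rewrite ler1n.
by rewrite py eqxx in xy.
Qed.

(** A graph distance is the largest pseudometric that is at most 1 along each
    edge. *)
Lemma graph_dist_edgewise (rho : vertex G -> vertex G -> R) C : 0 <= C ->
  (forall x, rho x x = 0) -> (forall x y, rho x y = rho y x) ->
  (forall x y z, rho x z <= rho x y + rho y z) ->
  (forall e, rho (ends e).1 (ends e).2 <= C) ->
  forall x y, rho x y <= C * graph_dist R x y.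
Proof.
move=> C0 rho0 rhoC rho_tri rho_edge x y.
have rho_path p : path (@Defs.adjacent G) x p -> rho x (last x p) <= C * (size p)%:R.
  elim: p x {y} => [|u p IH] x /=; first by rewrite rho0 mulr0.
  move=> /andP[/existsP[e xu] /IH rho_u]; apply: le_trans (rho_tri _ u _) _.
  rewrite -natr1 mulrDr mulr1 addrC lerD //.
  by case/orP: xu (rho_edge e) => /eqP -> //=; rewrite rhoC.
have [C_0|Cn0] := eqVneq C 0.
  have [m [p [xp <- _]]] := Gc x y.
  by have := rho_path p xp; rewrite C_0 !mul0r.
have Cp : 0 < C by rewrite lt_neqAle eq_sym Cn0.
rewrite -ler_pdivrMl //; apply: lb_le_inf; first exact: walk_set_nonempty.
by move=> _ [p [xp <-] <-]; rewrite ler_pdivrMl // rho_path.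
Qed.

End Dist.
End Walks.

(** * Copies of L_1 *)

(** The distance to u_0 in L_1; the distance to u_5 is 4 minus the height. *)
Definition height (i : 'I_6) : nat := nth 0 [:: 0; 1; 2; 2; 3; 4]%N i.

(** Every edge of L_1 climbs exactly one level, so averaging the two ends of a
    copy according to height sends each edge of the copy to a quarter of the
    edge that it replaces. *)
Lemma height_edge (a : 'I_6) : height (L1_ends a).2 = (height (L1_ends a).1).+1.
Proof. by case: a => [[|[|[|[|[|[|]]]]]] ?] //=; rewrite /height !inordK. Qed.

(** The map [phi] may identify vertices; it stands both for the identity of
    L_1 and for the embedding of a copy of L_1 in a refined graph. *)
Section L1Copy.
Variables (G : graph) (phi : 'I_6 -> vertex G).
Hypothesis phi_edge : forall a, walk 1 (phi (L1_ends a).1) (phi (L1_ends a).2).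

Lemma walk_bottom (i : 'I_6) : walk (height i) (phi ord0) (phi i).
Proof.
pose v k := phi (inord k); have E k (k6 : (k < 6)%N) := phi_edge (Ordinal k6).
have -> : phi ord0 = v 0%N by congr phi; apply: val_inj; rewrite /= inordK.
have -> : phi i = v i by rewrite /v inord_val.
(* The edges 0, 1, 2, 3 and 5 of L_1 form a spanning tree. *)
have w1 : walk 1 (v 0%N) (v 1%N) := E 0%N isT.
have w2 : walk 2 (v 0%N) (v 2%N) := walk_trans w1 (E 1%N isT).
have w3 : walk 2 (v 0%N) (v 3%N) := walk_trans w1 (E 2%N isT).
have w4 : walk 3 (v 0%N) (v 4%N) := walk_trans w2 (E 3%N isT).
have w5 : walk 4 (v 0%N) (v 5%N) := walk_trans w4 (E 5%N isT).
by case: i => [[|[|[|[|[|[|]]]]]] ?] //=; exact: walk_refl.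
Qed.

Lemma walk_top (i : 'I_6) : walk (4 - height i) (phi i) (phi ord_max).
Proof.
pose v k := phi (inord k); have E k (k6 : (k < 6)%N) := phi_edge (Ordinal k6).
have -> : phi ord_max = v 5%N by congr phi; apply: val_inj; rewrite /= inordK.
have -> : phi i = v i by rewrite /v inord_val.
have w4 : walk 1 (v 4%N) (v 5%N) := E 5%N isT.
have w3 : walk 2 (v 3%N) (v 5%N) := walk_trans (E 4%N isT) w4.
have w2 : walk 2 (v 2%N) (v 5%N) := walk_trans (E 3%N isT) w4.
have w1 : walk 3 (v 1%N) (v 5%N) := walk_trans (E 1%N isT) w2.
have w0 : walk 4 (v 0%N) (v 5%N) := walk_trans (E 0%N isT) w1.
by case: i => [[|[|[|[|[|[|]]]]]] ?] //=; exact: walk_refl.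
Qed.

(** Going round through both ends of the copy takes 8 steps in total, so one
    of the two ways from [phi i] to [phi j] takes at most 4. *)
Lemma walk_L1_copy (i j : 'I_6) : walk 4 (phi i) (phi j).
Proof.
have h4 k : (height k <= 4)%N by case: k => [[|[|[|[|[|[|]]]]]] ?].
have [ij|ij] := leqP (height i + height j) 4.
  exact: walk_le ij (walk_trans (walk_sym (walk_bottom i)) (walk_bottom j)).
apply: walk_le (walk_trans (walk_top i) (walk_sym (walk_top j))).
have := h4 i; have := h4 j.
by move: ij; case: (height i) => [|[|[|[|[|]]]]] //; case: (height j) => [|[|[|[|[|]]]]].
Qed.

End L1Copy.

Section Replace.
Variable G : graph.
Let G' := replace_edges G.
Implicit Types e : edge G.

(** The vertices u_1, ..., u_4 of L_1. *)
Definition inner (j : 'I_4) : 'I_6 := inord j.+1.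

Lemma copy_inner e (j : 'I_4) : copy_vertex e (inner j) = inr (e, j).
Proof.
have j6 : (j.+1 < 6)%N by rewrite ltnS ltnW // ltnS.
rewrite /copy_vertex -!val_eqE /= /inner inordK //=.
rewrite ifF; last by apply: ltn_eqF; exact: ltn_ord j.
by rewrite inord_val.
Qed.

Lemma copy_edge e (a : 'I_6) :
  @walk G' 1 (copy_vertex e (L1_ends a).1) (copy_vertex e (L1_ends a).2).
Proof. exact: (@walk_edge G' (e, a)). Qed.

Lemma copy_bottom e : copy_vertex e ord0 = inl (ends e).1.
Proof. by []. Qed.

Lemma copy_top e : copy_vertex e ord_max = inl (ends e).2.
Proof. by []. Qed.

(** Each edge of the old graph becomes a walk of length 4 through its copy. *)
Lemma walk_inl m (x y : vertex G) : walk m x y -> @walk G' (4 * m) (inl x) (inl y).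
Proof.
move=> [p [xp <- pm]]; apply: (@walk_le _ (4 * size p)); first by rewrite leq_mul2l.
elim: p x xp {y m pm} => [|u p IH] x /=; first by move=> _; exact: walk_refl.
move=> /andP[/existsP[e xu] /IH w]; rewrite mulnS; apply: walk_trans w.
have w := walk_L1_copy (copy_edge e) ord0 ord_max.
rewrite copy_bottom copy_top in w.
by case/orP: xu w => /eqP -> //=; exact: walk_sym.
Qed.

Lemma replace_edges_connected : connected_graph G -> connected_graph G'.
Proof.
move=> Gc.
have old (v : vertex G') : exists x, @walk G' 4 v (inl x).
  case: v => [x|[e j]]; first by exists x; apply: walk_le (walk_refl _).
  by exists (ends e).1; rewrite -copy_inner; exact: (walk_L1_copy (copy_edge e) (inner j) ord0).
move=> v v'; have [[x vx] [x' vx']] := (old v, old v').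
have [m xx'] := Gc x x'; exists (4 + 4 * m + 4)%N.
exact: walk_trans (walk_trans vx (walk_inl xx')) (walk_sym vx').
Qed.

End Replace.

Lemma L1_connected : connected_graph L1.
Proof.
by move=> i j; exists 4%N; exact: (@walk_L1_copy L1 id (@walk_edge L1)).
Qed.

Lemma laakso_rec_connected n : connected_graph (laakso_rec n).
Proof. by elim: n => [|n IH]; [exact: L1_connected|exact: replace_edges_connected]. Qed.

(** * Cheap averaging orders on the Laakso graphs *)

Section Cheap.
Variable R : realType.

(** The number [w z] bounds the norm of the residual of [z], and [c] gives the
    coordinates of an edge [delta x - delta y] in the residual basis (see
    [coord_residual]); so [C] bounds the contribution of each edge to the
    constant d_1 of this basis.  By [graph_dist_edgewise] edges suffice. *)
Definition cheap_averaging (G : graph) (o : vertex G) (C : R) : Prop :=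
  exists (s : seq (vertex G)) (q : vertex G -> vertex G -> R) (w : vertex G -> nat),
  [/\ averaging o s q,
      forall z t, q z t != 0 -> walk (w z) z t &
      forall e : edge G, exists c : vertex G -> R,
        (forall f : vertex G -> R, f (ends e).1 - f (ends e).2 =
           \sum_z c z * (f z - \sum_t q z t * f t)) /\
        \sum_z `|c z| * (w z)%:R <= C].

Lemma sum_indicator (I : finType) (F : I -> R) i : \sum_j (i == j)%:R * F j = F i.
Proof.
rewrite (bigD1 i) //= eqxx mul1r big1 ?addr0 // => j.
by rewrite eq_sym => /negPf ->; rewrite mul0r.
Qed.

(** Sending every point to [o], an edge is the difference of two residuals,
    each of norm at most 4, the diameter of L_1. *)
Lemma cheap_averaging_L1 (o : 'I_6) : @cheap_averaging L1 o 8.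
Proof.
exists (rem o (enum 'I_6)), (fun _ t => (t == o)%:R), (fun=> 4%N); split.
- have mem x : x \in o :: rem o (enum 'I_6).
    rewrite inE; have [//|xo] := eqVneq x o.
    by rewrite mem_rem_uniq ?enum_uniq // inE xo mem_enum.
  split=> //.
  + by rewrite /= rem_uniq ?enum_uniq // andbT mem_rem_uniqF ?enum_uniq.
  + by move=> _; rewrite (bigD1 o) //= eqxx big1 ?addr0 // => t /negPf ->.
  + move=> x y xo; case: (eqVneq y o) => [-> _|_]; last by rewrite eqxx.
    by rewrite /= eqxx eq_sym (negPf xo).
- by move=> z t _; exact: (@walk_L1_copy L1 id (@walk_edge L1)).
- move=> e; set x := (ends e).1; set y := (ends e).2.
  exists (fun z => (x == z)%:R - (y == z)%:R); split=> [f|].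
    have -> : f x - f y = (f x - f o) - (f y - f o) by rewrite opprB addrA subrK.
    have E z : f z - f o = f z - \sum_t (t == o)%:R * f t.
      by under eq_bigr => t _ do rewrite eq_sym; rewrite sum_indicator.
    under [RHS]eq_bigr => z _ do rewrite -E mulrBl.
    by rewrite big_split /= sumrN !sum_indicator.
  apply: le_trans (_ : \sum_z ((x == z)%:R * 4 + (y == z)%:R * 4) <= _).
    apply: ler_sum => z _; rewrite -mulrDl ler_wpM2r //.
    by apply: le_trans (ler_normB _ _) _; rewrite !ger0_norm.
  by rewrite big_split /= !sum_indicator -natrD.
Qed.

Section Step.
Variables (G : graph) (q : vertex G -> vertex G -> R).
Let V' := (vertex G + edge G * 'I_4)%type.

(** A new vertex of height h in the copy replacing [e] is averaged over the
    ends of [e] with weights 1 - h/4 and h/4; old vertices keep their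
    averages. *)
Definition refine_average (z t : V') : R :=
  match z, t with
  | inl z, inl t => q z t
  | inr (e, j), inl t =>
      (1 - (height (inner j))%:R / 4) * ((ends e).1 == t)%:R +
      (height (inner j))%:R / 4 * ((ends e).2 == t)%:R
  | _, inr _ => 0
  end.

Lemma refine_average_old (f : V' -> R) z :
  \sum_t refine_average (inl z) t * f t = \sum_t q z t * f (inl t).
Proof.
rewrite big_sumType /= [X in _ + X]big1 ?addr0 // => t _.
by rewrite mul0r.
Qed.

Lemma refine_average_new (f : V' -> R) e j :
  \sum_t refine_average (inr (e, j)) t * f t =
  (1 - (height (inner j))%:R / 4) * f (inl (ends e).1) +
  (height (inner j))%:R / 4 * f (inl (ends e).2).
Proof.
rewrite big_sumType /= [X in _ + X]big1 ?addr0; last by move=> t _; rewrite mul0r.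
have E (a b : R) : \sum_t (a * ((ends e).1 == t)%:R + b * ((ends e).2 == t)%:R) *
    f (inl t) = a * f (inl (ends e).1) + b * f (inl (ends e).2).
  under eq_bigr => t _ do rewrite mulrDl -!mulrA.
  by rewrite big_split /= -!mulr_sumr !(sum_indicator (fun t => f (inl t))).
exact: E.
Qed.

Lemma L1_vertexP (i : 'I_6) :
  [\/ i = ord0, i = ord_max | exists j, i = inner j].
Proof.
case: (eqVneq i ord0) => [|i0]; first by constructor 1.
case: (eqVneq i ord_max) => [|i5]; first by constructor 2.
constructor 3; have ip : (0 < i)%N by rewrite lt0n.
have i4 : (i.-1 < 4)%N.
  rewrite -ltnS prednK //; rewrite -val_eqE /= in i5.
  by have := ltn_ord i; rewrite ltnS leq_eqVlt (negPf i5).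
by exists (Ordinal i4); rewrite /inner /= prednK // inord_val.
Qed.

(** At the two ends of the copy both sides vanish, because the interpolation
    by height is exact there; this treats all six vertices uniformly. *)
Lemma copy_residual (f : V' -> R) (e : edge G) (i : 'I_6) :
  \sum_v (copy_vertex e i == inr v)%:R *
     (f (inr v) - \sum_t refine_average (inr v) t * f t) =
  f (copy_vertex e i) - ((1 - (height i)%:R / 4) * f (inl (ends e).1) +
                         (height i)%:R / 4 * f (inl (ends e).2)).
Proof.
case: (L1_vertexP i) => [->|->|[j ->]].
- rewrite copy_bottom big1 => [|v _]; last by rewrite mul0r.
  by rewrite mul0r subr0 mul1r mul0r addr0 subrr.
- rewrite copy_top big1 => [|v _]; last by rewrite mul0r.
  have -> : height ord_max = 4%N by [].
  by rewrite divff // subrr mul0r mul1r add0r subrr.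
- rewrite copy_inner -(refine_average_new f).
  exact: (sum_indicator (fun v => f (inr v) - \sum_t refine_average (inr v) t * f t) (e, j)).
Qed.

End Step.

Lemma refine_averaging (G : graph) (o : vertex G) s (q : vertex G -> vertex G -> R) :
  averaging o s q ->
  averaging (inl o : vertex (replace_edges G))
    (map inl s ++ map inr (enum {: edge G * 'I_4})) (refine_average q).
Proof.
move=> sq; have e0 : inl o :: (map inl s ++ map inr (enum {: edge G * 'I_4})) =
  map inl (o :: s) ++ map inr (enum {: edge G * 'I_4}) by [].
have inl_inj : injective (@inl (vertex G) (edge G * 'I_4)) by move=> ? ? [].
have inr_inj : injective (@inr (vertex G) (edge G * 'I_4)) by move=> ? ? [].
have inr_notin v : inr v \notin map (@inl (vertex G) (edge G * 'I_4)) (o :: s).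
  by apply/mapP => -[].
have index_inl z : index (inl z) (map inl (o :: s) ++ map inr (enum {: edge G * 'I_4}))
    = index z (o :: s).
  by rewrite index_cat mem_map // (averaging_enum sq) index_map.
have h01 (j : 'I_4) : 0 <= 1 - (height (inner j))%:R / 4 :> R.
  rewrite subr_ge0 ler_pdivrMr // mul1r ler_nat.
  by rewrite /height; case: (inner j) => [[|[|[|[|[|[|]]]]]] ?].
split.
- rewrite e0 cat_uniq; apply/and3P; split.
  + by rewrite map_inj_uniq // (averaging_uniq sq).
  + by apply/hasPn => _ /mapP[v _ ->]; exact: inr_notin.
  + by rewrite map_inj_uniq // enum_uniq.
- move=> [z|v]; rewrite e0 mem_cat.
    by rewrite mem_map // (averaging_enum sq).
  by rewrite [X in _ || X]mem_map // mem_enum orbT.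
- move=> [z|[e j]] [t|t] //=; first exact: averaging_ge0 sq _ _.
  by rewrite addr_ge0 // mulr_ge0 // divr_ge0.
- have E v : \sum_t refine_average q v t = \sum_t refine_average q v t * 1.
    by apply: eq_bigr => t _; rewrite mulr1.
  move=> [z|[e j]]; rewrite E.
    rewrite refine_average_old -[RHS](averaging_sum sq z).
    by apply: eq_bigr => t _; rewrite mulr1.
  by rewrite refine_average_new !mulr1 subrK.
- by move=> [t|t] //=; rewrite (averaging_base sq).
- move=> [z|[e j]] [t|t] zo qzt; rewrite e0 ?index_inl.
  + by apply: (averaging_before sq) qzt; apply: contraNneq zo => ->.
  + by rewrite /= eqxx in qzt.
  + rewrite index_cat (negPf (inr_notin _)) size_map ltn_addr // index_mem.
    exact: averaging_enum sq _.
  + by rewrite /= eqxx in qzt.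
Qed.

(** Let x and y be the ends of a new edge in the copy replacing [e].  Then
    delta x - delta y is the difference of the residuals of x and y plus a
    quarter of the edge [e].  The residuals are zero or have norm at most 4,
    which adds 8; the bounds on the norms of the old residuals are multiplied
    by 4, which compensates exactly the factor 1/4. *)
Lemma cheap_averaging_replace (G : graph) (o : vertex G) C :
  cheap_averaging o C -> @cheap_averaging (replace_edges G) (inl o) (C + 8).
Proof.
move=> [s [q [w [sq wq costq]]]].
exists (map inl s ++ map inr (enum {: edge G * 'I_4})), (refine_average q),
  (fun v => if v is inl z then (4 * w z)%N else 4%N); split.
- exact: refine_averaging.
- move=> [z|[e j]] [t|t] /=; rewrite ?eqxx //; first by move/wq; exact: walk_inl.
  have [<- _|_] := eqVneq (ends e).1 t.
    rewrite -copy_inner; exact: (walk_L1_copy (copy_edge e) (inner j) ord0).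
  have [<- _|_] := eqVneq (ends e).2 t.
    rewrite -copy_inner; exact: (walk_L1_copy (copy_edge e) (inner j) ord_max).
  by rewrite !mulr0 addr0 eqxx.
- move=> [e a] /=; have [c [cE cC]] := costq e.
  set i := (L1_ends a).1; set j := (L1_ends a).2.
  exists (fun v => match v with inl z => c z / 4 | inr v =>
    (copy_vertex e i == inr v)%:R - (copy_vertex e j == inr v)%:R end); split=> [f|].
    rewrite [RHS]big_sumType /=.
    under [X in _ = X + _]eq_bigr => z _ do rewrite refine_average_old mulrAC.
    under [X in _ = _ + X]eq_bigr => v _ do rewrite mulrBl.
    rewrite -mulr_suml -(cE (fun z => f (inl z))) big_split /= sumrN !(copy_residual q).
    rewrite height_edge -/i -natr1.
    by field.
  rewrite [leLHS]big_sumType /=; apply: lerD.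
    apply: le_trans cC; apply: ler_sum => z _.
    by rewrite natrM normrM normfV (ger0_norm (ler0n _ _)) mulrA divfK.
  have ind x : \sum_v (x == inr v :> vertex (replace_edges G))%:R * (4 : R) <= 4.
    rewrite -mulr_suml ler_piMl //; case: x => [x|v].
      by rewrite big1.
    have := sum_indicator (fun=> 1) v.
    by under eq_bigr => u _ do rewrite mulr1; move=> ->.
  apply: le_trans (_ : 4 + 4 <= _); last by rewrite -natrD.
  apply: le_trans (lerD (ind (copy_vertex e i)) (ind (copy_vertex e j))).
  rewrite -big_split /=; apply: ler_sum => v _; rewrite -mulrDl ler_wpM2r //.
  by apply: le_trans (ler_normB _ _) _; rewrite !ger0_norm.
Qed.

Lemma cheap_averaging_laakso n (o : 'I_6) : cheap_averaging (laakso_rec_incl n o) (8 * n.+1)%:R.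
Proof.
elim: n => [|n IH]; first exact: cheap_averaging_L1.
by rewrite mulnSr natrD; exact: cheap_averaging_replace.
Qed.

Lemma sd1_le_cheap (G : graph) (o : vertex G) (C : R) : connected_graph G -> 0 <= C ->
  cheap_averaging o C -> (sd1 (@graph_dist R G) o <= C%:E)%E.
Proof.
move=> Gc C0 [s [q [w [sq wq costq]]]].
have d0 := graph_dist_ge0 R Gc; have dp := graph_dist_gt0 R Gc.
apply: le_trans (ereal_inf_lbound _) _.
  by exists (residual_basis o s q); [exact: residual_basis_stochastic|reflexivity].
rewrite lee_fin; apply: d1_basis_le => //.
pose b := residual_basis o s q.
apply: (@graph_dist_edgewise G R Gc (fun x y => \sum_(i < #|vertex G|.-1)
  `|coord b i (delta R o x - delta R o y)| * free_norm (@graph_dist R G) b`_i)) => //.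
- by move=> x; rewrite big1 // => i _; rewrite subrr linear0 normr0 mul0r.
- by move=> x y; apply: eq_bigr => i _; rewrite -opprB linearN normrN.
- move=> x y z; rewrite -big_split; apply: ler_sum => i _ /=.
  rewrite -mulrDl ler_wpM2r ?free_norm_ge0 //.
  rewrite -[delta R o x - _](subrKA (delta R o y)) linearD.
  exact: ler_normD.
- move=> e; have [c [cE cC]] := costq e.
  apply: le_trans cC; apply: (residual_basis_cost sq d0 dp) => // z t qzt.
  exact: graph_dist_le_walk (wq z t qzt).
Qed.

End Cheap.

(** * The bound for the Laakso graphs *)

Theorem theorem4p2 (R : realType) (k : nat) (hk : (1 <= k)%N) (o : 'I_6) :
  (d1 (@graph_dist R (laakso k)) (laakso_incl k o)
     <= sd1 (@graph_dist R (laakso k)) (laakso_incl k o)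
     <= (8 * k)%:R%:E)%E.
Proof.
have Gc := @laakso_rec_connected k.-1.
apply/andP; split.
  by apply: d1_le_sd1; [exact: graph_dist_ge0 R Gc|exact: graph_dist_gt0 R Gc].
apply: sd1_le_cheap => //.
by have := @cheap_averaging_laakso R k.-1 o; rewrite prednK.
Qed.
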